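(* Let $S$ be a sampling with replacement consisting of $\tau$ independent draws from a distribution on $[n]$ with probabilities $\tilde p_i>0$. Let each $f_i:\mathbb{R}^d\to\mathbb{R}$ be $L_i$-smooth and convex, and let $f=\frac1n\sum_{i=1}^nf_i$ be $L_f$-smooth and convex. Then the expected smoothness constant $\mathcal{L}_2$ (defined in the context) satisfies $$\mathcal{L}_2\le\frac{1}{n\tau}\max_{i\in[n]}\frac{L_i}{\tilde p_i}.$$
   Context: $[n]=\{1,\dots,n\}$; $e\in\mathbb{R}^n$ is the all-ones vector. $L$-smooth means differentiable with $L$-Lipschitz gradient. Sampling with replacement: $S$ is the multiset of $\tau\ge1$ independent indices, each equal to $i$ with probability $\tilde p_i$. Weights: $\theta_S^i=1/(\tau\tilde p_i)$; $\theta_S$ is the diagonal matrix with these entries; $\mathbf{I}_S$ is the diagonal matrix whose $i$-th entry is the number of copies of $i$ in $S$; $\mathbf{G}(x)=[\nabla f_1(x),\dots,\nabla f_n(x)]$. Thus $\frac1n\mathbf{G}(x)\theta_S\mathbf{I}_Se=\frac1n\sum_{i\in S}\frac{1}{\tau\tilde p_i}\nabla f_i(x)$ with multiplicities. $\mathcal{L}_2$ is the smallest constant $\ge0$ such that for all $x,y\in\mathbb{R}^d$: $\mathbb{E}\left[\|\frac1n(\mathbf{G}(x)-\mathbf{G}(y))\theta_S\mathbf{I}_Se-\frac1n(\mathbf{G}(x)-\mathbf{G}(y))e\|^2\right]\le2\mathcal{L}_2(f(x)-f(y)-\langle\nabla f(y),x-y\rangle)$. *)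

(* Defs.v *)
From HB Require Import structures.
From mathcomp Require Import all_boot all_order all_algebra.
From mathcomp Require Import all_classical all_reals all_analysis.
Set Implicit Arguments.
Unset Strict Implicit.
Unset Printing Implicit Defensive.
Import Order.TTheory GRing.Theory Num.Theory.
Import numFieldNormedType.Exports.
Local Open Scope classical_set_scope.
Local Open Scope ring_scope.

(* The library norm `|u| on matrices is the sup norm; it induces the usual
   topology (hence the usual notion of differentiability), but Lipschitz
   constants must be measured in the Euclidean norm defined here. *)
Definition dotp (R : realType) (d : nat) (u v : 'cV[R]_d) : R :=
  (u^T *m v) 0 0.

Definition enorm (R : realType) (d : nat) (u : 'cV[R]_d) : R :=
  Num.sqrt (dotp u u).

Definition grad (R : realType) (d : nat) (f : 'cV[R]_d -> R) (x : 'cV[R]_d) :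
    'cV[R]_d :=
  \col_j 'D_(delta_mx j 0) f x.

(* For d >= 1 the condition 0 <= L follows from the Lipschitz inequality. *)
Definition L_smooth (R : realType) (d : nat) (L : R) (f : 'cV[R]_d -> R) :
    Prop :=
  [/\ 0 <= L,
      forall x, differentiable f x &
      forall x y, enorm (grad f x - grad f y) <= L * enorm (x - y)].

Definition convex_fun (R : realType) (d : nat) (f : 'cV[R]_d -> R) : Prop :=
  @convex_function R 'cV[R]_d setT f.

Definition avg_fun (R : realType) (d n : nat) (f : 'I_n -> 'cV[R]_d -> R)
    (x : 'cV[R]_d) : R :=
  n%:R^-1 * \sum_(i < n) f i x.

Definition mutually_independent (dT : measure_display) (T : measurableType dT)
    (R : realType) (P : probability T R) (n tau : nat)
    (S : 'I_tau -> T -> 'I_n) : Prop :=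
  forall (J : {set 'I_tau}) (A : 'I_tau -> set 'I_n),
    P (\bigcap_(k in [set` J]) (S k @^-1` A k)) =
    (\prod_(k in J) P (S k @^-1` A k))%E.

(* S k is the k-th drawn index. All subsets of 'I_n are taken as measurable. *)
Definition sampling_with_replacement (dT : measure_display)
    (T : measurableType dT) (R : realType) (P : probability T R) (n tau : nat)
    (p : 'I_n -> R) (S : 'I_tau -> T -> 'I_n) : Prop :=
  [/\ forall k (A : set 'I_n), measurable (S k @^-1` A),
      forall k i, P (S k @^-1` [set i]) = (p i)%:E &
      mutually_independent P S].

Definition Gmx (R : realType) (d n : nat) (f : 'I_n -> 'cV[R]_d -> R)
    (x : 'cV[R]_d) : 'M[R]_(d, n) :=
  \matrix_(j < d, i < n) grad (f i) x j 0.

Definition ones (R : realType) (n : nat) : 'cV[R]_n := const_mx 1.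

Definition theta_mx (R : realType) (n : nat) (tau : nat) (p : 'I_n -> R) :
    'M[R]_n :=
  diag_mx (\row_i (1 / (tau%:R * p i))).

Definition copies (n tau : nat) (s : 'I_tau -> 'I_n) (i : 'I_n) : nat :=
  #|[set k | s k == i]%SET|.

Definition count_mx (R : realType) (n tau : nat) (s : 'I_tau -> 'I_n) :
    'M[R]_n :=
  diag_mx (\row_i (copies s i)%:R).

Definition est_error (R : realType) (d n tau : nat)
    (f : 'I_n -> 'cV[R]_d -> R) (p : 'I_n -> R) (s : 'I_tau -> 'I_n)
    (x y : 'cV[R]_d) : 'cV[R]_d :=
  n%:R^-1 *: ((Gmx f x - Gmx f y) *m theta_mx tau p *m count_mx R s *m ones R n)
  - n%:R^-1 *: ((Gmx f x - Gmx f y) *m ones R n).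

Definition expected_smoothness_constants (dT : measure_display)
    (T : measurableType dT) (R : realType) (P : probability T R)
    (d n tau : nat) (f : 'I_n -> 'cV[R]_d -> R) (p : 'I_n -> R)
    (S : 'I_tau -> T -> 'I_n) : set R :=
  [set C | 0 <= C /\
    forall x y : 'cV[R]_d,
      ('E_P[fun w => (enorm (est_error f p (fun k => S k w) x y) ^+ 2)%R] <=
       (2 * C * (avg_fun f x - avg_fun f y
                 - dotp (grad (avg_fun f) y) (x - y)))%:E)%E].

Definition is_calL2 (dT : measure_display)
    (T : measurableType dT) (R : realType) (P : probability T R)
    (d n tau : nat) (f : 'I_n -> 'cV[R]_d -> R) (p : 'I_n -> R)
    (S : 'I_tau -> T -> 'I_n) (L2 : R) : Prop :=
  expected_smoothness_constants P f p S L2 /\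
  lbound (expected_smoothness_constants P f p S) L2.

(* Main.v *)
Require Import Defs.
From HB Require Import structures.
From mathcomp Require Import all_boot all_order all_algebra.
From mathcomp Require Import all_classical all_reals all_analysis.
From mathcomp Require Import ring lra.
Import Order.TTheory GRing.Theory Num.Theory.
Import numFieldNormedType.Exports.
Local Open Scope classical_set_scope.
Local Open Scope ring_scope.

(** The bound combines two estimates, written with the gradient differences
    g_i = grad (f i) x - grad (f i) y and the Bregman divergences
    D_i = f i x - f i y - <grad (f i) y, x - y>.

    - Cocoercivity ([cocoercive_bregman]): a convex L-smooth function satisfies
      |g|^2 <= 2 L D. As a function of its first argument the Bregman divergence
      is convex, L-smooth and nonnegative ([bregman_ge0]), and by the descent
      lemma ([descent]), if L > 0, a gradient step of length 1/L from x decreases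
      it by at least |g|^2 / (2 L).

    - Variance ([expectation_sqnorm_sum], [variance_le_second_moment]): the
      estimation error is the mean of tau independent copies of the vector equal
      to v_i = g_i / (n p_i) - (1/n) sum_j g_j with probability p_i. Since
      sum_i p_i v_i = 0, the cross terms vanish and the expected square norm is
      (1/tau) sum_i p_i |v_i|^2, which is at most
      (1/tau) sum_i |g_i|^2 / (n^2 p_i).

    Inserting |g_i|^2 <= 2 L_i D_i and bounding each L_i / p_i by the maximum M
    gives at most 2 (M / (n tau)) (1/n) sum_i D_i, and (1/n) sum_i D_i is the
    Bregman divergence of the average. So M / (n tau) is an admissible
    constant; the infimum of the admissible constants is itself admissible
    because the defining inequalities are closed conditions
    ([least_constant]). *)

(** * The Euclidean inner product *)

Section Dotp.
Context {R : realType} {d : nat}.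
Implicit Types (u v w : 'cV[R]_d) (a c : R).

Lemma dotpE u v : dotp u v = \sum_j u j 0 * v j 0.
Proof. by rewrite /dotp mxE; apply: eq_bigr => j _; rewrite mxE. Qed.

Lemma dotpC u v : dotp u v = dotp v u.
Proof. by rewrite !dotpE; apply: eq_bigr => j _; rewrite mulrC. Qed.

Lemma dotpDr u v w : dotp u (v + w) = dotp u v + dotp u w.
Proof. by rewrite /dotp mulmxDr mxE. Qed.

Lemma dotpZr a u v : dotp u (a *: v) = a * dotp u v.
Proof. by rewrite /dotp -scalemxAr mxE. Qed.

Lemma dotpDl u v w : dotp (u + v) w = dotp u w + dotp v w.
Proof. by rewrite dotpC dotpDr !(dotpC w). Qed.

Lemma dotpZl a u v : dotp (a *: u) v = a * dotp u v.
Proof. by rewrite dotpC dotpZr dotpC. Qed.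

Lemma dotpNr u v : dotp u (- v) = - dotp u v.
Proof. by rewrite -scaleN1r dotpZr mulN1r. Qed.

Lemma dotpNl u v : dotp (- u) v = - dotp u v.
Proof. by rewrite dotpC dotpNr dotpC. Qed.

Lemma dotpBr u v w : dotp u (v - w) = dotp u v - dotp u w.
Proof. by rewrite dotpDr dotpNr. Qed.

Lemma dotpBl u v w : dotp (u - v) w = dotp u w - dotp v w.
Proof. by rewrite dotpDl dotpNl. Qed.

Lemma dotp_sumr (I : finType) u (F : I -> 'cV[R]_d) :
  dotp u (\sum_i F i) = \sum_i dotp u (F i).
Proof. by rewrite /dotp mulmx_sumr summxE. Qed.

Lemma dotp_suml (I : finType) (F : I -> 'cV[R]_d) u :
  dotp (\sum_i F i) u = \sum_i dotp (F i) u.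
Proof. by rewrite dotpC dotp_sumr; apply: eq_bigr => i _; rewrite dotpC. Qed.

Lemma dotp_ge0 u : 0 <= dotp u u.
Proof. by rewrite dotpE sumr_ge0 // => j _; rewrite -expr2 sqr_ge0. Qed.

Lemma enorm_ge0 u : 0 <= enorm u.
Proof. exact: sqrtr_ge0. Qed.

Lemma enorm_sqr u : enorm u ^+ 2 = dotp u u.
Proof. by rewrite sqr_sqrtr // dotp_ge0. Qed.

(** The consequence of the Cauchy-Schwarz inequality needed below; it follows
    directly from the nonnegativity of the square norm of u - c v. *)
Lemma dotp_le_of_enorm_le c u v :
  0 < c -> enorm u <= c * enorm v -> dotp u v <= c * dotp v v.
Proof.
move=> c0 uv.
have uu : dotp u u <= c ^+ 2 * dotp v v.
  rewrite -!enorm_sqr -exprMn ler_pXn2r// nnegrE ?enorm_ge0//.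
  by rewrite mulr_ge0 ?enorm_ge0// ltW.
have := dotp_ge0 (u - c *: v).
rewrite !(dotpBl, dotpBr, dotpZl, dotpZr) (dotpC v u) => h.
rewrite -(ler_pM2l c0); nra.
Qed.

End Dotp.

(** * Smooth convex functions *)

Section Gradient.
Context {R : realType} {d : nat}.
Implicit Types (f : 'cV[R]_d -> R) (x y h : 'cV[R]_d).

Lemma derive_grad f x h : differentiable f x -> 'D_h f x = dotp (grad f x) h.
Proof.
move=> df; rewrite deriveE// dotpE.
rewrite [in LHS](matrix_sum_delta h) linear_sum; apply: eq_bigr => j _.
by rewrite big_ord1 linearZ /= mxE deriveE// mulrC.
Qed.

(** Bregman divergence of f at x relative to the base point y. *)
Definition bregman f x y : R := f x - f y - dotp (grad f y) (x - y).

Lemma is_derive_line f x h (t : R) : differentiable f (x + t *: h) ->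
  is_derive t 1 (fun s : R => f (x + s *: h)) (dotp (grad f (x + t *: h)) h).
Proof.
move=> df; have dh : derivable f (x + t *: h) h by exact: diff_derivable.
have E : (fun s : R => s^-1 *: (f (x + (s *: 1 + t) *: h) - f (x + t *: h)))
   = (fun s : R => s^-1 *: (f (s *: h + (x + t *: h)) - f (x + t *: h))).
  apply/funext => s; congr (_ *: (f _ - _)).
  by rewrite [s *: 1]mulr1 scalerDl addrCA.
apply: DeriveDef; first by rewrite /derivable /= E.
by rewrite -derive_grad// /derive /= E.
Qed.

(** A convex function lies above its tangent plane. *)
Lemma bregman_ge0 f x y : differentiable f y -> convex_fun f ->
  0 <= bregman f x y.
Proof.
move=> df cf; rewrite /bregman subr_ge0 -derive_grad//.
have dh : derivable f y (x - y) by exact: diff_derivable.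
have cv : (fun t : R => t^-1 *: (f (t *: (x - y) + y) - f y)) @ 0^'+
    --> 'D_(x - y) f y.
  exact: cvg_dnbhs_at_right dh.
(* By convexity the difference quotients at t in (0, 1] are at most
   f x - f y. *)
apply: (cvgr_to_le cv).
near=> t.
have t0 : 0 < t by near: t; exact: nbhs_right_gt.
have t1 : t <= 1 by near: t; exact: nbhs_right_le.
rewrite [leLHS](_ : _ = t^-1 * (f (t *: (x - y) + y) - f y))// ler_pdivrMl//.
have := cf (Itv01 (ltW t0) t1) x y (in_setT _) (in_setT _).
rewrite convRE /= /conv /=.
rewrite (_ : t *: x + _ = t *: (x - y) + y); last first.
  by rewrite scalerBr scalerBl scale1r addrA addrAC.
by rewrite /unstable.onem; lra.
Unshelve. all: by end_near. Qed.

(** Descent lemma: an L-smooth function lies below its quadratic upper model. *)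
Lemma descent L f x h : 0 < L -> L_smooth L f ->
  f (x + h) <= f x + dotp (grad f x) h + L / 2 * dotp h h.
Proof.
move=> L0 [_ df lipf].
(* Up to the constant f x, psi is the gap between f and its model along the
   segment. Its derivative dpsi is nonpositive on (0, 1), so the mean value
   theorem gives psi 1 <= psi 0. *)
pose psi t := f (x + t *: h)
  - (t * dotp (grad f x) h + t ^+ 2 * (L / 2 * dotp h h)).
pose dpsi t := dotp (grad f (x + t *: h)) h
  - (dotp (grad f x) h + t * (L * dotp h h)).
have D (t : R) : is_derive t 1 psi (dpsi t).
  have ? := @is_derive_line f x h t (df _).
  apply: is_derive_eq.
  by rewrite /dpsi /GRing.scale /=; field.
have [|c /andP[c0 c1]] := @MVT R psi dpsi 0 1 ltr01 (fun t _ => D t).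
  apply: derivable_within_continuous => t _.
  by have [] := D t.
rewrite subr0 mulr1 /psi scale1r scale0r addr0 => E.
have : dpsi c <= 0.
  rewrite /dpsi opprD addrA subr_le0 -dotpBl mulrA.
  apply: dotp_le_of_enorm_le; first by rewrite mulrC mulr_gt0.
  apply: le_trans (lipf _ _) _.
  rewrite addrAC subrr add0r /enorm dotpZl dotpZr mulrA -expr2.
  rewrite sqrtrM ?sqr_ge0// sqrtr_sqr gtr0_norm// mulrA.
  by rewrite (mulrC c).
by rewrite -E; lra.
Qed.

(** Cocoercivity of the gradient, in Bregman form. *)
Lemma cocoercive_bregman L f x y : L_smooth L f -> convex_fun f ->
  dotp (grad f x - grad f y) (grad f x - grad f y) <= 2 * L * bregman f x y.
Proof.
move=> sf cf; have [L0 df lipf] := sf.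
(* For L = 0 the gradient is constant and both sides vanish. *)
have [L_eq0|L_neq0] := eqVneq L 0.
  have g0 : enorm (grad f x - grad f y) = 0.
    apply/eqP; rewrite eq_le enorm_ge0 andbT.
    by have := lipf x y; rewrite L_eq0 mul0r.
  by rewrite -enorm_sqr g0 L_eq0 expr0n /= mulr0 mul0r.
have Lgt0 : 0 < L by rewrite lt_neqAle eq_sym L_neq0.
have [g gE] : exists g, g = grad f x - grad f y by exists (grad f x - grad f y).
rewrite -gE.
(* One gradient step of length 1 / L from x for z |-> bregman f z y, which is
   nonnegative, decreases it by at least dotp g g / (2 * L). *)
have B := bregman_ge0 f (x + (- L^-1) *: g) y (df y) cf.
have D := descent L f x ((- L^-1) *: g) Lgt0 sf.
have gg : dotp g g = dotp (grad f x) g - dotp (grad f y) g.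
  by rewrite {1}gE dotpBl.
move: B D; rewrite /bregman !(dotpBr, dotpDr, dotpZr, dotpZl) => B D.
have step : 0 <= f x - f y - (dotp (grad f y) x - dotp (grad f y) y)
    - L^-1 / 2 * dotp g g.
  have LL : L / 2 * (- L^-1 * (- L^-1 * dotp g g)) = L^-1 / 2 * dotp g g.
    by field.
  by move: D; rewrite LL => D; move: B D; rewrite gg; lra.
have := mulr_ge0 (ltW Lgt0) step.
by rewrite mulrBr !mulrA divff// mul1r; lra.
Qed.

End Gradient.

Section Average.
Context {R : realType} {d n : nat}.
Implicit Types (f : 'I_n -> 'cV[R]_d -> R) (x y : 'cV[R]_d).

Lemma grad_avg_fun f x : (forall i, differentiable (f i) x) ->
  grad (avg_fun f) x = n%:R^-1 *: \sum_i grad (f i) x.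
Proof.
move=> df; apply/colP => j; rewrite !mxE summxE.
have E : avg_fun f = n%:R^-1 *: (\sum_(i < n) f i).
  by apply/funext => z; rewrite /avg_fun fct_sumE.
have di i : derivable (f i) x (delta_mx j 0) by exact: diff_derivable.
rewrite E deriveZ; last exact: derivable_sum.
rewrite derive_sum//; congr (_ * _).
by apply: eq_bigr => i _; rewrite mxE.
Qed.

Lemma bregman_avg_fun f x y : (forall i, differentiable (f i) y) ->
  bregman (avg_fun f) x y = n%:R^-1 * \sum_i bregman (f i) x y.
Proof.
move=> df; rewrite /bregman grad_avg_fun// dotpZl dotp_suml /avg_fun.
by rewrite !sumrB !mulrBr.
Qed.

End Average.

(** * The estimation error as a mean of centered vectors *)

Section Estimator.
Context {R : realType} {d n : nat}.

(** Value, when index i is drawn, of the centered single-draw estimator of the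
    mean of the vectors g. *)
Definition deviation (p : 'I_n -> R) (g : 'I_n -> 'cV[R]_d) i : 'cV[R]_d :=
  (n%:R * p i)^-1 *: g i - n%:R^-1 *: \sum_j g j.

Lemma natr_copies (tau : nat) (s : 'I_tau -> 'I_n) i :
  (copies s i)%:R = \sum_k (s k == i)%:R :> R.
Proof.
rewrite /copies -sum1_card natr_sum [RHS](bigID (fun k => s k == i)) /=.
rewrite [X in _ = _ + X]big1 ?addr0; last by move=> k /negbTE ->.
apply: eq_big => [k|k]; first by rewrite inE.
by rewrite inE => /eqP ->; rewrite eqxx.
Qed.

Lemma est_errorE (tau : nat) (f : 'I_n -> 'cV[R]_d -> R) (p : 'I_n -> R)
    (s : 'I_tau -> 'I_n) (x y : 'cV[R]_d) : (0 < tau)%N ->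
  est_error f p s x y = tau%:R^-1 *:
    \sum_k deviation p (fun i => grad (f i) x - grad (f i) y) (s k).
Proof.
move=> tau0; have tau_neq0 : tau%:R != 0 :> R by rewrite pnatr_eq0 -lt0n.
rewrite /est_error /deviation sumrB sumr_const card_ord scalerBr.
rewrite -[(_ *: _) *+ _]scaler_nat !scalerA mulrA mulVf// mul1r; congr (_ - _).
- rewrite /theta_mx /count_mx !mul_mx_diag; apply/colP => j.
  rewrite !mxE summxE !mulr_sumr.
  under eq_bigr => i _.
    rewrite !mxE mulr1 natr_copies !mulr_sumr.
    over.
  rewrite exchange_big /=; apply: eq_bigr => k _.
  rewrite (bigD1 (s k)) //= big1 ?addr0 => [|i]; last first.
    by rewrite eq_sym => /negbTE ->; rewrite !mulr0.
  by rewrite eqxx !mxE mul1r mulr1 !invfM; ring.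
- congr (_ *: _); apply/colP => j; rewrite !mxE summxE.
  by apply: eq_bigr => i _; rewrite !mxE mulr1.
Qed.

Lemma sum_deviation (p : 'I_n -> R) (g : 'I_n -> 'cV[R]_d) :
  (forall i, 0 < p i) -> \sum_i p i = 1 -> \sum_i p i *: deviation p g i = 0.
Proof.
move=> p0 p1; rewrite /deviation.
under eq_bigr => i _.
  rewrite scalerBr scalerA invfM mulrCA divff ?gt_eqF// mulr1.
  over.
by rewrite sumrB -scaler_sumr -scaler_suml p1 scale1r subrr.
Qed.

(** The variance of the single-draw estimator is at most its second moment; the
    difference is the square norm of the mean. *)
Lemma variance_le_second_moment (p : 'I_n -> R) (g : 'I_n -> 'cV[R]_d) :
  (forall i, 0 < p i) -> \sum_i p i = 1 ->
  \sum_i p i * dotp (deviation p g i) (deviation p g i) <=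
  \sum_i dotp (g i) (g i) / (n%:R ^+ 2 * p i).
Proof.
move=> p0 p1.
have [m mE] : exists m, m = n%:R^-1 *: \sum_j g j by eexists.
have S0 := sum_deviation p g p0 p1.
have E i : dotp (g i) (g i) / (n%:R ^+ 2 * p i) =
    p i * dotp (deviation p g i) (deviation p g i)
    + 2 * dotp (p i *: deviation p g i) m + p i * dotp m m.
  have n0 : n%:R != 0 :> R by rewrite pnatr_eq0 -lt0n (leq_trans _ (ltn_ord i)).
  have pi0 : p i != 0 by rewrite gt_eqF.
  have -> : g i = (n%:R * p i) *: (deviation p g i + m).
    by rewrite /deviation -mE subrK scalerA divff ?scale1r// mulf_neq0.
  move: (deviation p g i) => v.
  rewrite !(dotpZl, dotpZr, dotpDl, dotpDr) (dotpC m).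
  by field; apply/andP.
rewrite (eq_bigr _ (fun i _ => E i)) !big_split /=.
rewrite -mulr_sumr -dotp_suml S0 -mulr_suml p1 mul1r.
by rewrite /dotp trmx0 mul0mx mxE mulr0 addr0 lerDl dotp_ge0.
Qed.

End Estimator.

(** * Second moment of a sum of independent draws *)

Section Sampling.
Context {dT : measure_display} {T : measurableType dT} {R : realType}.
Context (P : probability T R).

Lemma expectation_indic_comb (I : finType) (c : I -> R) (A : I -> set T) :
  (forall i, measurable (A i)) ->
  'E_P[fun w => (\sum_i c i * \1_(A i) w)%R]%E = (\sum_i (c i)%:E * P (A i))%E.
Proof.
move=> mA; rewrite unlock.
have intA i : P.-integrable setT (fun w => (c i)%:E * (\1_(A i) w)%:E)%E.
  by apply: integrableZl => //; exact: integrable_indic.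
under eq_integral do rewrite -sumEFin.
rewrite integral_sum//; apply: eq_bigr => i _.
under eq_integral do rewrite EFinM.
rewrite integralZl//; first by rewrite integral_indic// setIT.
exact: integrable_indic.
Qed.

Context {n tau : nat} {p : 'I_n -> R} {S : 'I_tau -> T -> 'I_n}.
Context (hS : sampling_with_replacement P p S).

(** Joint law of the k-th and l-th draws; the draws coincide when k = l. *)
Definition pair_law (k l : 'I_tau) (i j : 'I_n) : R :=
  if k == l then (i == j)%:R * p i else p i * p j.

Lemma pair_lawE k l i j :
  P (S k @^-1` [set i] `&` S l @^-1` [set j]) = (pair_law k l i j)%:E.
Proof.
have [_ law ind] := hS; rewrite /pair_law; have [<-|kl] := eqVneq k l.
  have [<-|ij] := eqVneq i j; first by rewrite setIid law mul1r.
  rewrite mul0r -preimage_setI (_ : _ `&` _ = set0) ?preimage_set0 ?measure0//.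
  by apply/seteqP; split => z //= [-> /eqP]; rewrite (negbTE ij).
(* Independence on the index set {k, l}; only the values of A at k and l
   matter. *)
pose A m := if m == k then [set i] else [set j].
have Ak : A k = [set i] by rewrite /A eqxx.
have Al : A l = [set j] by rewrite /A eq_sym (negbTE kl).
have := ind [set k; l]%SET A.
rewrite big_setU1 ?inE// big_set1 Ak Al !law EFinM => <-; congr (P _).
rewrite -Ak -Al; apply/seteqP; split => w /=.
  by move=> [wk wl] m; rewrite /= !inE => /orP[]/eqP ->.
by move=> w_in; split; apply: w_in; rewrite /= !inE eqxx ?orbT.
Qed.

(** The integrand takes finitely many values: it is a linear combination of the
    indicators of the events that draw k gives i and draw l gives j. *)
Lemma expectation_double_sum (h : 'I_n -> 'I_n -> R) :
  'E_P[fun w => (\sum_k \sum_l h (S k w) (S l w))%R]%E =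
  (\sum_k \sum_l \sum_i \sum_j h i j * pair_law k l i j)%:E.
Proof.
have [mS _ _] := hS.
pose A (q : ('I_tau * 'I_tau) * ('I_n * 'I_n)) :=
  S q.1.1 @^-1` [set q.2.1] `&` S q.1.2 @^-1` [set q.2.2].
pose c (q : ('I_tau * 'I_tau) * ('I_n * 'I_n)) := h q.2.1 q.2.2.
have -> : (fun w => \sum_k \sum_l h (S k w) (S l w)) =
    (fun w => \sum_q c q * \1_(A q) w).
  apply/funext => w.
  rewrite -(pair_bigA _ (fun u v => c (u, v) * \1_(A (u, v)) w)) /=.
  rewrite pair_bigA; apply: eq_bigr => -[k l] _ /=.
  rewrite (bigD1 (S k w, S l w)) //= big1 ?addr0.
    by rewrite /c /A /= indicE mem_set ?mulr1.
  move=> [i j] /eqP ij; rewrite indicE memNset ?mulr0//.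
  by move=> [/= ki lj]; apply: ij; rewrite -ki -lj.
rewrite expectation_indic_comb; last by move=> q; exact: measurableI.
under eq_bigr => q _ do rewrite /A pair_lawE -EFinM.
rewrite sumEFin; congr EFin.
rewrite -(pair_bigA _ (fun u v => c (u, v) * pair_law u.1 u.2 v.1 v.2)) /=.
rewrite [RHS]pair_bigA; apply: eq_bigr => -[k l] _ /=.
by rewrite pair_bigA; apply: eq_bigr => -[i j] _.
Qed.

(** Square norms of sums of independent centered vectors add up in
    expectation. *)
Lemma expectation_sqnorm_sum {d : nat} (v : 'I_n -> 'cV[R]_d) :
  \sum_i p i *: v i = 0 ->
  'E_P[fun w => dotp (\sum_k v (S k w)) (\sum_k v (S k w))]%E =
  (tau%:R * \sum_i p i * dotp (v i) (v i))%:E.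
Proof.
move=> v0.
have -> : (fun w => dotp (\sum_k v (S k w)) (\sum_k v (S k w))) =
    (fun w => \sum_k \sum_l dotp (v (S k w)) (v (S l w))).
  apply/funext => w; rewrite dotp_suml.
  by apply: eq_bigr => k _; rewrite dotp_sumr.
rewrite (expectation_double_sum (fun i j => dotp (v i) (v j))).
congr EFin; rewrite mulr_natl -[X in _ *+ X]card_ord -sumr_const.
apply: eq_bigr => k _; rewrite (bigD1 k)//= [X in _ + X]big1 ?addr0; last first.
  (* Two distinct draws contribute the square norm of the zero mean. *)
  move=> l /negbTE lk.
  rewrite -[RHS](_ : dotp (\sum_i p i *: v i) (\sum_i p i *: v i) = 0);
    last first.
    by rewrite v0 /dotp mulmx0 mxE.
  rewrite dotp_suml; apply: eq_bigr => i _.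
  rewrite dotp_sumr; apply: eq_bigr => j _.
  by rewrite /pair_law eq_sym lk dotpZl dotpZr; ring.
apply: eq_bigr => i _; rewrite (bigD1 i)//= big1 ?addr0 => [|j].
  by rewrite /pair_law !eqxx mul1r mulrC.
by rewrite /pair_law eqxx eq_sym => /negbTE ->; rewrite mul0r mulr0.
Qed.

End Sampling.

(** * The least admissible constant *)

Section LeastConstant.
Context {R : realType} {I : Type}.

(** A family of inequalities e <= 2 c D with D nonnegative that holds for some
    c >= 0 has a least such c. *)
Lemma least_constant (e D : I -> R) (C : R) :
    (forall z, 0 <= D z) -> 0 <= C -> (forall z, e z <= 2 * C * D z) ->
  exists C0 : R, [/\ 0 <= C0, forall z, e z <= 2 * C0 * D z &
    forall C', 0 <= C' -> (forall z, e z <= 2 * C' * D z) -> C0 <= C'].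
Proof.
move=> D0 C_ge0 hC; pose A := [set c | 0 <= c /\ forall z, e z <= 2 * c * D z].
have AC : A C by split.
have lb0 : lbound A 0 by move=> c [].
have hasA : has_inf A by split; [exists C | exists 0].
exists (inf A); split=> [|z|c c0 hc]; first by apply: lb_le_inf => //; exists C.
  have [Dz0|Dz0] := eqVneq (D z) 0.
    (* If D z = 0, the right-hand side does not depend on the constant. *)
    by rewrite Dz0 mulr0 -[leRHS](mulr0 (2 * C)) -Dz0.
  have Dz : 0 < D z by rewrite lt_neqAle eq_sym Dz0 D0.
  rewrite -ler_pdivrMr// -ler_pdivrMl//; apply: lb_le_inf; first by exists C.
  by move=> c [_ hc]; rewrite ler_pdivrMl// ler_pdivrMr.
by apply: ge_inf; [exists 0 | split].
Qed.

End LeastConstant.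

(** * The bound on the expected smoothness constant *)

(* The summands of the maximum are nonnegative and n >= 1 (since the p i sum
   to 1), so the default value 0 of the big maximum is harmless. The least
   constant is unique whenever it exists, by antisymmetry. *)
Theorem lemmaF7 (R : realType) (d n tau : nat)
    (dT : measure_display) (T : measurableType dT) (P : probability T R)
    (p : 'I_n -> R) (S : 'I_tau -> T -> 'I_n)
    (f : 'I_n -> 'cV[R]_d -> R) (L : 'I_n -> R) (Lf : R)
    (htau : (1 <= tau)%N)
    (hp : forall i, 0 < p i)
    (hp1 : \sum_(i < n) p i = 1)
    (hS : sampling_with_replacement P p S)
    (hf_smooth : forall i, L_smooth (L i) (f i))
    (hf_convex : forall i, convex_fun (f i))
    (hF_smooth : L_smooth Lf (avg_fun f))
    (hF_convex : convex_fun (avg_fun f)) :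
  exists L2 : R,
    is_calL2 P f p S L2 /\
    L2 <= 1 / (n%:R * tau%:R) * \big[Num.max/0]_(i < n) (L i / p i).
Proof.
set M := \big[Num.max/0]_(i < n) (L i / p i).
pose C := 1 / (n%:R * tau%:R) * M.
have df i x : differentiable (f i) x by have [] := hf_smooth i.
pose g (z : 'cV[R]_d * 'cV[R]_d) i := grad (f i) z.1 - grad (f i) z.2.
pose e z := tau%:R^-1 *
  \sum_i p i * dotp (deviation p (g z) i) (deviation p (g z) i).
pose D z := bregman (avg_fun f) z.1 z.2.
have tau_gt0 : 0 < tau%:R :> R by rewrite ltr0n.
have expE x y :
    'E_P[fun w => (enorm (est_error f p (fun k => S k w) x y) ^+ 2)%R]%E
    = (e (x, y))%:E.
  pose v := deviation p (g (x, y)).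
  have -> : (fun w => enorm (est_error f p (fun k => S k w) x y) ^+ 2) =
      (fun w => dotp (\sum_k (tau%:R^-1 *: v (S k w)))
                     (\sum_k (tau%:R^-1 *: v (S k w)))).
    by apply/funext => w; rewrite enorm_sqr est_errorE// scaler_sumr.
  rewrite (expectation_sqnorm_sum P hS (fun i => tau%:R^-1 *: v i)).
    congr EFin; rewrite /e -/v mulr_sumr [RHS]mulr_sumr; apply: eq_bigr => i _.
    by rewrite dotpZl dotpZr; field; rewrite gt_eqF.
  under eq_bigr => i _ do rewrite scalerA mulrC -scalerA.
  by rewrite -scaler_sumr sum_deviation// scaler0.
have D_ge0 z : 0 <= D z.
  by apply: bregman_ge0 => //; have [] := hF_smooth.
have C_ge0 : 0 <= C.
  by rewrite mulr_ge0 ?divr_ge0 ?mulr_ge0// /M bigmax_ge_id.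
have eC z : e z <= 2 * C * D z.
  rewrite /D bregman_avg_fun//.
  have -> : 2 * C * (n%:R^-1 * \sum_i bregman (f i) z.1 z.2) =
      tau%:R^-1 * \sum_i (2 * M * n%:R ^- 2) * bregman (f i) z.1 z.2.
    by rewrite -mulr_sumr /C mul1r invfM -exprVn; ring.
  rewrite ler_pM2l ?invr_gt0//.
  apply: le_trans (variance_le_second_moment p (g z) hp hp1) _.
  apply: ler_sum => i _.
  have B0 : 0 <= bregman (f i) z.1 z.2 by exact: bregman_ge0.
  have n2_gt0 : 0 < n%:R ^+ 2 :> R.
    by rewrite exprn_gt0// ltr0n (leq_trans _ (ltn_ord i)).
  have ML : L i / p i <= M by apply: le_bigmax_cond.
  rewrite ler_pdivrMr; last exact: mulr_gt0.
  apply: le_trans (cocoercive_bregman (L i) (f i) z.1 z.2 _ _) _ => //.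
  have -> : 2 * M * n%:R ^- 2 * bregman (f i) z.1 z.2 * (n%:R ^+ 2 * p i) =
      2 * (M * p i) * bregman (f i) z.1 z.2.
    by field; rewrite pnatr_eq0 -lt0n (leq_trans _ (ltn_ord i)).
  by rewrite ler_wpM2r// ler_pM2l// -ler_pdivrMr.
have [C0 [C0_ge0 hC0 C0_min]] := least_constant e D C D_ge0 C_ge0 eC.
exists C0; split; last exact: C0_min.
split; first by split => // x y; rewrite expE lee_fin; exact: hC0 (x, y).
move=> c [c_ge0 hc]; apply: C0_min => // -[x y].
by have := hc x y; rewrite expE lee_fin.
Qed.
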